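(* Let $(X,d)$ be a compact metric space and let $f\in Hom(X)$ admit a continuous strict Lyapunov function. Suppose that one of the following hypotheses holds: (i) $\mathcal{GR}(f)=\mathcal{CR}(f)$; (ii) $\mathcal{CR}(f)$ is strictly contained in $X$; (iii) $f$ is topologically stable. Then there exists a neighborhood $V$ of $f$ in $Hom(X)$ such that any $g\in V$ admits a continuous strict Lyapunov function.
   Context: $Hom(X)$ is the space of homeomorphisms of $X$ with the uniform topology induced by $d_{\mathscr{C}^0}(f,g)=\max_{x\in X}d(f(x),g(x))$. A continuous function $u:X\to\mathbb{R}$ is a Lyapunov function for $f$ if $u(f(x))\le u(x)$ for every $x\in X$; it is strict if it is not a first integral, i.e. there exists $x\in X$ with $u(f(x))<u(x)$. Chain recurrence: given $x,y\in X$ and $\varepsilon>0$, an $\varepsilon$-chain for $f$ from $x$ to $y$ is a finite sequence $(x_i)_{i=1}^n$ ($n\ge1$) in $X$ with $x_1=x$ and, setting $x_{n+1}=y$, $d(f(x_i),x_{i+1})<\varepsilon$ for all $i=1,\dots,n$. $\mathcal{CR}(f)$ is the set of $x\in X$ such that for every $\varepsilon>0$ there is an $\varepsilon$-chain from $x$ to $x$. Strong chain recurrence: a strong $\varepsilon$-chain from $x$ to $y$ (for the metric $d$) is a finite sequence $(x_i)_{i=1}^n$ ($n\ge1$) in $X$ with $x_1=x$ and, setting $x_{n+1}=y$, $\sum_{i=1}^n d(f(x_i),x_{i+1})<\varepsilon$. $\mathcal{SCR}_d(f)$ is the set of $x\in X$ such that for every $\varepsilon>0$ there is a strong $\varepsilon$-chain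 from $x$ to $x$. The generalized recurrent set is $\mathcal{GR}(f)=\bigcap_{d'}\mathcal{SCR}_{d'}(f)$, the intersection being over all metrics $d'$ compatible with the topology of $X$. $f\in Hom(X)$ is topologically stable if there exists a neighborhood $V$ of $f$ in $Hom(X)$ such that for each $g\in V$ there is a continuous function $h_g:X\to X$ satisfying: (a) $h_g\circ g=f\circ h_g$; (b) $h_g\to id$ as $g\to f$ in the uniform topology. *)

(* Defs.v *)
From HB Require Import structures.
From mathcomp Require Import all_boot all_order all_algebra.
From mathcomp Require Import all_classical all_reals all_analysis.
Import Order.TTheory GRing.Theory Num.Theory.
Import numFieldNormedType.Exports.

Set Implicit Arguments.
Unset Strict Implicit.
Unset Printing Implicit Defensive.

Local Open Scope classical_set_scope.
Local Open Scope ring_scope.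

Definition is_homeo (T : topologicalType) (f : T -> T) : Prop :=
  continuous f /\ exists2 g : T -> T, cancel f g /\ cancel g f & continuous g.

(* As a type, [homeo X] carries the topology induced by uniform convergence;
   [nbhs_homeoE] below shows that it is the one given by [dC0]. *)
Definition homeo (X : uniformType) : set {uniform X -> X} :=
  [set f | is_homeo (f : X -> X)].
Arguments homeo X : clear implicits.

(* The supremum is a maximum when f and g are continuous and X is compact and
   nonempty. *)
Definition dC0 (R : realType) (X : metricType R) (f g : X -> X) : R :=
  sup (range (fun x => mdist (f x) (g x))).

Section Recurrence.
Context (R : realType) (X : topologicalType).
Implicit Types (d : X -> X -> R) (f : X -> X) (u : X -> R).

Definition is_metric d : Prop :=
  [/\ forall x y, 0 <= d x y,
      forall x y, d x y = 0 <-> x = y,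
      forall x y, d x y = d y x
    & forall x y z, d x z <= d x y + d y z].

Definition compatible_metric d : Prop :=
  is_metric d /\
  forall (x : X) (A : set X),
    nbhs x A <-> exists2 e : R, 0 < e & [set y | d x y < e] `<=` A.

(* The points x_1, ..., x_n, x_(n+1) of a chain are c 0, ..., c n; the values
   of c beyond n are irrelevant. *)
Definition chain d f (e : R) (x y : X) : Prop :=
  exists (n : nat) (c : nat -> X),
    [/\ (0 < n)%N, c 0%N = x, c n = y
      & forall i, (i < n)%N -> d (f (c i)) (c i.+1) < e].

Definition strong_chain d f (e : R) (x y : X) : Prop :=
  exists (n : nat) (c : nat -> X),
    [/\ (0 < n)%N, c 0%N = x, c n = y
      & \sum_(0 <= i < n) d (f (c i)) (c i.+1) < e].

Definition chain_recurrent d f : set X :=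
  [set x | forall e, 0 < e -> chain d f e x x].

Definition strong_chain_recurrent d f : set X :=
  [set x | forall e, 0 < e -> strong_chain d f e x x].

Definition generalized_recurrent f : set X :=
  \bigcap_(d in [set d | compatible_metric d]) strong_chain_recurrent d f.

Definition lyapunov f u : Prop :=
  continuous u /\ forall x, u (f x) <= u x.

Definition strict_lyapunov f u : Prop :=
  lyapunov f u /\ exists x, u (f x) < u x.

End Recurrence.
Arguments generalized_recurrent R {X} f.

(* The conjugating maps form a family g |-> h g; it only matters on V, which
   is a neighborhood of f, so the limit does not depend on its values off V. *)
Definition topologically_stable (X : uniformType) (f : homeo X) : Prop :=
  exists2 V : set (homeo X), nbhs f V &
  exists h : homeo X -> {uniform X -> X},
    (forall g, V g ->
       continuous (h g : X -> X) /\
       forall x, h g (set_val g x) = set_val f (h g x)) /\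
    h g @[g --> f] --> (idfun : {uniform X -> X}).

Section UniformDistance.
Context (R : realType) (X : metricType R) (cX : compact [set: X]).

Lemma has_ubound_dC0 (f g : X -> X) :
  has_ubound (range (fun x => mdist (f x) (g x))).
Proof.
have [[x0 _]|X0] := pselect (exists x : X, True); last first.
  by exists 0 => _ [x _ <-]; exfalso; apply: X0; exists x.
have /compact_near_coveringP cX' := cX.
have H : \forall M \near +oo, [set: X] `<=` (fun x => mdist x0 x < M).
  apply: (cX' R +oo (fun M x => mdist x0 x < M)) => x _.
  exists (ball x 1, [set M | mdist x0 x + 1 < M]) => /=.
    split; first exact: nbhsx_ballx.
    by exists (mdist x0 x + 1); split; [exact: num_real|].
  move=> [y M] /= [xy] /(lt_trans _); apply.
  rewrite (le_lt_trans (metric_triangle _ x _))// ltrD2l.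
  by move: xy; rewrite ballEmdist.
have [M HM] : exists M : R, [set: X] `<=` (fun x => mdist x0 x < M).
  by case: (@filter_ex R +oo _ _ H) => M ?; exists M.
exists (M + M) => _ [x _ <-].
rewrite (le_trans (metric_triangle _ x0 _))// lerD//.
  by rewrite metric_sym ltW// HM.
by rewrite ltW// HM.
Qed.

Lemma nbhs_dC0E (f : {uniform X -> X}) (V : set {uniform X -> X}) :
  nbhs f V <-> exists2 e : R, 0 < e & [set g | dC0 (f : X -> X) g < e] `<=` V.
Proof.
rewrite uniform_nbhs; split.
  move=> [E [entE EV]]; move: entE; rewrite -entourage_ballE => -[e /= e0 eE].
  exists e => // g /= fg; apply: EV => y _; apply: eE => /=.
  rewrite ballEmdist /=; apply: le_lt_trans fg.
  by apply: ub_le_sup; [exact: has_ubound_dC0|exists y].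
move=> [e e0 eV]; exists [set xy | ball xy.1 (e / 2) xy.2]; split.
  by rewrite -entourage_ballE; exists (e / 2) => //=; rewrite divr_gt0.
move=> g /= fg; apply: eV => /=.
have [[x0 _]|X0] := pselect (exists x : X, True); last first.
  rewrite /dC0 [X in sup X](_ : _ = set0) ?sup0//.
  by rewrite -subset0 => z [x _ _]; exfalso; apply: X0; exists x.
apply: (@le_lt_trans _ _ (e / 2)); last by rewrite ltr_pdivrMr// ltr_pMr// ltr1n.
apply: ge_sup; first by exists (mdist (f x0) (g x0)), x0.
by move=> _ [x _ <-]; have := fg x I; rewrite ballEmdist => /ltW.
Qed.

Lemma nbhs_homeoE (f : homeo X) (V : set (homeo X)) :
  nbhs f V <->
  exists2 e : R, 0 < e & [set g | dC0 (set_val f) (set_val g) < e] `<=` V.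
Proof.
split.
  case=> _ /= [[W oW <-] /= Wf WV].
  have /nbhs_dC0E [e e0 eW] := open_nbhs_nbhs (conj oW Wf).
  by exists e => // g /= fg; apply: WV; exact: eW.
move=> [e e0 eV].
have fe : nbhs (set_val f) [set g : {uniform X -> X} | dC0 (set_val f) g < e].
  by apply/nbhs_dC0E; exists e.
have := @initial_continuous (homeo X) {uniform X -> X} set_val f _ fe.
by move=> fV; apply: (@filterS _ (nbhs f) _ _ _ eV fV).
Qed.

End UniformDistance.

(* Main.v *)
(** If [x] is not chain recurrent, then the points reached from [x] by
    [e]-chains form a trapping region [S] that contains every point at distance
    less than [e] from the image of [x |` S]; the distance to that image,
    truncated at [e], is then a Lyapunov function, and it is strict at [x].
    Failure of chain recurrence at scale [e] persists, at scale [e / 2], under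
    perturbations of size [e / 2], which settles (ii).  Case (i) reduces to
    (ii): for a Lyapunov function [u] of [f], the metric
    [d x y + `|u x - u y|] shows that the points where [u] strictly decreases
    are not in the generalized recurrent set.  In case (iii), [u \o h g] is a
    Lyapunov function for [g], strict where [u] is as soon as [h g] is close to
    the identity. *)
Require Import Defs.
From mathcomp Require Import all_boot all_order all_algebra.
From mathcomp Require Import all_classical all_reals all_analysis.
From mathcomp Require Import lra.
Import Order.TTheory GRing.Theory Num.Theory.
Import numFieldNormedType.Exports.

Local Open Scope classical_set_scope.
Local Open Scope ring_scope.

Lemma chain1 (R : realType) (X : topologicalType) (d : X -> X -> R)
    (f : X -> X) (e : R) (x y : X) : d (f x) y < e -> chain d f e x y.
Proof.
move=> xy; exists 1%N, (fun i => if i is 0%N then x else y); split => //.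
by case.
Qed.

Lemma chain_rcons (R : realType) (X : topologicalType) (d : X -> X -> R)
    (f : X -> X) (e : R) (x y z : X) :
  chain d f e x y -> d (f y) z < e -> chain d f e x z.
Proof.
move=> [n [c [n0 c0 cn cE]]] yz.
exists n.+1, (fun i => if (i <= n)%N then c i else z); split => //.
  by rewrite ltnn.
move=> i; rewrite ltnS => ilen; rewrite ilen; case: ltnP => [/cE//|nlei].
have -> : i = n by apply/eqP; rewrite eqn_leq ilen nlei.
by rewrite cn.
Qed.

Section MetricSpace.
Context (R : realType) (X : metricType R).
Implicit Types (A : set X) (f g : X -> X) (u : X -> R).

(** The infimum is the distance from [y] to [A]; by convention it is [0] when [A] is empty, a case
    treated apart. *)
Lemma inf_mdist_ge0 A y : 0 <= inf [set mdist a y | a in A].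
Proof.
have [->|/set0P[a Aa]] := eqVneq A set0; first by rewrite image_set0 inf0.
by apply: lb_le_inf => [|_ [b _ <-]]; [exists (mdist a y), a|exact: mdist_ge0].
Qed.

Lemma inf_mdist_le A a y : A a -> inf [set mdist a y | a in A] <= mdist a y.
Proof.
move=> Aa; apply: ge_inf; last by exists a.
by exists 0 => _ [b _ <-]; exact: mdist_ge0.
Qed.

Lemma inf_mdist_lipschitz A y z :
  inf [set mdist a y | a in A] <= inf [set mdist a z | a in A] + mdist z y.
Proof.
have [->|/set0P[a Aa]] := eqVneq A set0.
  by rewrite !image_set0 inf0 add0r mdist_ge0.
rewrite -lerBlDr; apply: lb_le_inf; first by exists (mdist a z), a.
move=> _ [b Ab <-]; rewrite lerBlDr.
by apply: le_trans (metric_triangle b z y); exact: inf_mdist_le.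
Qed.

Lemma continuous_inf_mdist A :
  continuous (fun y => inf [set mdist a y | a in A]).
Proof.
move=> y; apply/cvgrPdist_lt => e e0.
near=> z.
have yz : mdist y z < e.
  near: z; have := nbhsx_ballx y e e0.
  by rewrite ballEmdist.
apply: le_lt_trans yz; rewrite ler_norml.
have := inf_mdist_lipschitz A y z; rewrite metric_sym.
have := inf_mdist_lipschitz A z y.
by move=> zy yz; apply/andP; split; lra.
Unshelve. all: by end_near. Qed.

Lemma not_chain_strict_lyapunov f (e : R) (x : X) :
  0 < e -> ~ chain (@mdist R X) f e x x ->
  exists u : X -> R, strict_lyapunov f u.
Proof.
(* [x] itself lies outside [S]; adding it puts [f x] in [A], so that [A] is nonempty and
   [D (f x) = 0]. *)
move=> e0 xx; pose S := [set y | chain (@mdist R X) f e x y].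
pose A := f @` (x |` S); pose D y := inf [set mdist a y | a in A].
have fx y : S y -> D (f y) = 0.
  move=> Sy; apply/eqP; rewrite eq_le inf_mdist_ge0 andbT -(mdistxx (f y)).
  by apply: inf_mdist_le; exists y => //; right.
(* A point closer than [e] to [A] ends a chain from [x]: append it to a chain reaching a point of
   [S], or step to it directly from [x]. *)
have DS y : ~ S y -> e <= D y.
  move=> nSy; rewrite leNgt; apply/negP => /inf_lt[].
    by exists (mdist (f x) y), (f x) => //; exists x => //; left.
  move=> _ [_ [z xSz <-] <-] zy; apply: nSy; rewrite /S /=.
  by case: xSz zy => [->|/= xz]; [exact: chain1|exact: chain_rcons].
have fx0 : D (f x) = 0.
  apply/eqP; rewrite eq_le inf_mdist_ge0 andbT -(mdistxx (f x)).
  by apply: inf_mdist_le; exists x => //; left.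
exists (fun y => Num.min (D y) e); split; [split|].
- move=> y; apply: (@continuous_min R X D (fun=> e)).
    exact: continuous_inf_mdist.
  exact: cst_continuous.
(* On [S] the value after [f] is the minimum [0]; off [S] the value before [f] is the maximum
   [e]. *)
- move=> y; have [/fx ->|/DS eDy] := pselect (S y).
    by rewrite min_l ?(ltW e0)// le_min inf_mdist_ge0 ltW.
  by rewrite (min_r eDy) ge_min lexx orbT.
- by exists x; rewrite fx0 (min_r (DS _ xx)) min_l // ltW.
Qed.

(** The same points serve as a chain for [f], each step making a detour through [g (c i)]. *)
Lemma chain_perturb f g (e e' : R) (x y : X) :
  (forall z, mdist (f z) (g z) < e') -> chain (@mdist R X) g e x y ->
  chain (@mdist R X) f (e' + e) x y.
Proof.
move=> fg [n [c [n0 c0 cn cE]]]; exists n, c; split => // i /cE ?.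
by apply: le_lt_trans (metric_triangle _ (g (c i)) _) _; exact: ltrD.
Qed.

(** The extra term makes [u] 1-Lipschitz, and continuity of [u] keeps the topology unchanged. *)
Lemma compatible_mdistD u : continuous u ->
  compatible_metric (fun x y => mdist x y + `|u x - u y|).
Proof.
move=> cu; split; first split.
- by move=> x y; rewrite addr_ge0// mdist_ge0.
- move=> x y; split => [/eqP|->]; last by rewrite mdistxx subrr normr0 addr0.
  by rewrite paddr_eq0 ?mdist_ge0// => /andP[/eqP/mdist_positivity].
- by move=> x y; rewrite metric_sym distrC.
- move=> x y z; rewrite addrACA lerD//; first exact: metric_triangle.
  exact: ler_distD.
move=> x A; split.
  move=> /nbhs_ballP[e /= e0 xeA]; exists e => // y /= xy; apply: xeA.
  by rewrite ballEmdist /=; apply: le_lt_trans xy; rewrite lerDl.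
move=> [e e0 xeA]; have e20 : 0 < e / 2 by rewrite divr_gt0.
have /cvgrPdist_lt/(_ _ e20) ux := cu x.
have xx := nbhsx_ballx x _ e20.
apply: filterS2 ux xx => y uxy; rewrite ballEmdist /= => xy.
by apply: xeA => /=; rewrite (splitr e) ltrD.
Qed.

Lemma generalized_recurrent_lyapunov f u (x : X) : lyapunov f u ->
  generalized_recurrent R f x -> u (f x) = u x.
Proof.
move=> [cu uf] /(_ _ (compatible_mdistD _ cu)) /= fx.
apply/eqP; rewrite eq_le uf /= leNgt; apply/negP; rewrite -subr_gt0.
(* The drop [u x - u (f x)] serves as the scale: a closed strong chain must be at least that long to
   climb back. *)
move=> /fx[[|n] [c [//= _ c0 cn]]]; apply/negP; rewrite -leNgt.
(* Telescoping: each step raises [u] by at most the length of the step, and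
   the total variation of [u] along the closed chain vanishes. *)
apply: (@le_trans _ _ (\sum_(0 <= i < n.+1) (u (c i.+1) - u (f (c i))))).
  have : \sum_(0 <= i < n.+1) (u (c i.+1) - u (c i)) = 0.
    by rewrite telescope_sumr// cn c0 subrr.
  (* The first term carries the drop at [x]; the others only use that [u] does not increase along
     [f]. *)
  rewrite !big_nat_recl// c0 => tel.
  have : \sum_(0 <= i < n) (u (c i.+2) - u (c i.+1)) <=
         \sum_(0 <= i < n) (u (c i.+2) - u (f (c i.+1))).
    by apply: ler_sum => i _; rewrite lerD2l lerN2.
  by move: tel; lra.
apply: ler_sum => i _; rewrite (le_trans (ler_norm _))// distrC.
by rewrite lerDr mdist_ge0.
Qed.

Lemma le_dC0 f g (x : X) : compact [set: X] -> mdist (f x) (g x) <= dC0 f g.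
Proof.
by move=> cX; apply: ub_le_sup; [exact: has_ubound_dC0|exists x].
Qed.

Lemma not_chain_recurrent_stable (f : homeo X) (x : X) : compact [set: X] ->
  ~ chain_recurrent (@mdist R X) (set_val f) x ->
  \forall g \near f, exists u : X -> R, strict_lyapunov (set_val g) u.
Proof.
move=> cX; rewrite /chain_recurrent /= => /existsNP[e /not_implyP[e0 xx]].
have e20 : 0 < e / 2 by rewrite divr_gt0.
apply/(nbhs_homeoE cX); exists (e / 2) => // g /= fg.
apply: (@not_chain_strict_lyapunov _ (e / 2) x) => // gxx.
apply: xx; rewrite (splitr e); apply: chain_perturb gxx => z.
by apply: le_lt_trans fg; exact: le_dC0.
Qed.

Lemma topologically_stable_lyapunov (f : homeo X) u : compact [set: X] ->
  strict_lyapunov (set_val f) u -> topologically_stable f ->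
  \forall g \near f, exists v : X -> R, strict_lyapunov (set_val g) v.
Proof.
move=> cX [[cu uf] [x ufx]] [V Vf [h [hV hf]]].
have cf : continuous (set_val f : X -> X) by case: (set_valP f).
(* Strict decrease is an open condition, so it passes from [x] to [h g x] for [g] near [f]. *)
have nbx : \forall y \near x, u (set_val f y) < u y.
  have cvg : (fun y => u y - u (set_val f y)) @ x --> u x - u (set_val f x).
    apply: cvgB; first exact: cu.
    apply: (@continuous_comp _ _ _ (set_val f : X -> X) u).
      exact: cf.
    exact: cu.
  have := cvgr_gt _ cvg 0; rewrite subr_gt0 => /(_ _ ufx).
  by apply: filterS => y; rewrite subr_gt0.
have hx : \forall k \near (idfun : {uniform X -> X}),
    u (set_val f (k x)) < u (k x).
  move/nbhs_ballP: nbx => [e /= e0 xe]; apply/(nbhs_dC0E cX).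
  exists e => // k /= ke; apply: xe; rewrite ballEmdist /=.
  by apply: le_lt_trans ke; exact: (@le_dC0 idfun k x).
have {}hx := hf _ hx.
apply: filterS2 Vf hx => g /hV[ch hg] hgx.
exists (u \o (h g : X -> X)); split; [split|].
- by move=> y; apply: continuous_comp; [exact: ch|exact: cu].
- by move=> y; rewrite /= hg.
- by exists x; rewrite /= hg.
Qed.

End MetricSpace.

Theorem proposition5p1 (R : realType) (X : metricType R) (f : homeo X) :
  compact [set: X] ->
  (exists u : X -> R, strict_lyapunov (set_val f) u) ->
  [\/ generalized_recurrent R (set_val f) = chain_recurrent (@mdist R X) (set_val f),
      chain_recurrent (@mdist R X) (set_val f) `<` [set: X]
    | topologically_stable f] ->
  exists2 V : set (homeo X), nbhs f V &
    forall g, V g -> exists u : X -> R, strict_lyapunov (set_val g) u.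
Proof.
move=> cX [u fu] hyp.
(* With the largest candidate for [V], only the neighborhood property remains. *)
exists [set g | exists u : X -> R, strict_lyapunov (set_val g) u] => //.
case: hyp => [GC|[_ /existsNP[x /not_implyP[_ nx]]]|tf].
- have [lu [x ufx]] := fu.
  apply: (@not_chain_recurrent_stable _ _ _ x) => //; rewrite -GC.
  by move=> /(generalized_recurrent_lyapunov _ _ _ _ _ lu) ux; rewrite ux ltxx in ufx.
- exact: not_chain_recurrent_stable nx.
- exact: topologically_stable_lyapunov fu tf.
Qed.
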